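(* Let $f(x)=\tfrac12x^{\top}Gx-a^{\top}x$ on $\mathbb{R}^n$, with $G\in\mathbb{R}^{n\times n}$ symmetric positive definite and $a\in\mathbb{R}^n$. Let $A\in\mathbb{R}^{n\times k}$ have full column rank, let $b_{\mathcal A}\in\mathbb{R}^k$ and $n_*\in\mathbb{R}^n$, and let $x\in\mathbb{R}^n$, $u\in\mathbb{R}^k$, $u_*\in\mathbb{R}$ satisfy $A^{\top}x=b_{\mathcal A}$ and $Gx-a=Au+u_*n_*$. Let $J,R,d,z,r$ be as in the context, and for $t\in\mathbb{R}$ let $x(t)=x+tz$. Then $$f(x(t))-f(x)=t\Bigl(\frac t2+u_*\Bigr)\,n_*^{\top}z ,$$ and this is strictly positive whenever $z\neq0$ and $t\neq0$ and $t,u_*$ have the same sign, in the sense $t\,u_*\ge0$ (in particular whenever $z\ne 0$, $t>0$ and $u_*\ge0$).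
   Context: $J\in\mathbb{R}^{n\times n}$ and the upper triangular nonsingular matrix $R\in\mathbb{R}^{k\times k}$ satisfy $J^{\top}GJ=I_n$ and $J^{\top}A=\begin{bmatrix}R\\0\end{bmatrix}$. Partition $J=[\,J_1\ \ J_2\,]$ with $J_1\in\mathbb{R}^{n\times k}$. Set $d=J^{\top}n_*=(d_1,d_2)$ with $d_1\in\mathbb{R}^k$, $z=J_2d_2$, and $r=R^{-1}d_1$. In the source, $A$ holds the normals of the working-set constraints, $n_*$ is the normal of the entering constraint, $u$ are the working-set multipliers, and $u_*$ is the entering constraint's multiplier (initially $0$). *)

(* Defs.v *)
From mathcomp Require Import all_boot all_order all_algebra reals.

Set Implicit Arguments.
Unset Strict Implicit.
Unset Printing Implicit Defensive.

Import Order.TTheory GRing.Theory Num.Theory.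
Local Open Scope ring_scope.

(* u^T v, as a scalar rather than a 1 x 1 matrix *)
Definition dotv (K : realType) (n : nat) (u v : 'cV[K]_n) : K :=
  (u^T *m v) 0 0.

Definition posdef (K : realType) (n : nat) (G : 'M[K]_n) : Prop :=
  forall v : 'cV[K]_n, v != 0 -> 0 < dotv v (G *m v).

Definition quad_obj (K : realType) (n : nat) (G : 'M[K]_n) (a x : 'cV[K]_n) : K :=
  2^-1 * dotv x (G *m x) - dotv a x.

(* [is_trig_mx] means lower triangular, hence the transpose. *)
Definition upper_triangular (K : realType) (k : nat) (R : 'M[K]_k) : Prop :=
  is_trig_mx R^T.

(* The number of columns of J is written k + (n - k) so that the blocks J1 and
   J2 can be formed without casts; it equals n because A : 'M_(n, k) having
   full column rank forces k <= n, so J is square and 1%:M below is I_n. *)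
Definition working_set_factorization (K : realType) (n k : nat)
    (G : 'M[K]_n) (A : 'M[K]_(n, k))
    (J : 'M[K]_(n, k + (n - k))) (R : 'M[K]_k) : Prop :=
  [/\ upper_triangular R, R \in unitmx,
      J^T *m G *m J = 1%:M & J^T *m A = col_mx R 0].

(* Main.v *)
(* Write J = [J1 J2].  The factorization gives J2^T G J2 = I and J2^T A = 0, so
   the step z = J2 J2^T nstar is orthogonal to the columns of A and satisfies
   z^T G z = nstar^T z.  Stationarity then gives the slope
   z^T (G x - a) = ustar * nstar^T z in the second-order expansion of the
   objective along z. *)

Require Import Defs.
From mathcomp Require Import all_boot all_order all_algebra reals.
From mathcomp Require Import ring.

Set Implicit Arguments.
Unset Strict Implicit.
Unset Printing Implicit Defensive.

Import Order.TTheory GRing.Theory Num.Theory.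
Local Open Scope ring_scope.

Section DotProduct.

Variables (K : realType) (n : nat).
Implicit Types u v w : 'cV[K]_n.

Lemma dotvC u v : dotv u v = dotv v u.
Proof. by rewrite /dotv -[in LHS](trmxK (u^T *m v)) mxE trmx_mul trmxK. Qed.

Lemma dotvDr u v w : dotv u (v + w) = dotv u v + dotv u w.
Proof. by rewrite /dotv mulmxDr mxE. Qed.

Lemma dotvZr c u v : dotv u (c *: v) = c * dotv u v.
Proof. by rewrite /dotv -scalemxAr mxE. Qed.

Lemma dotvDl u v w : dotv (u + v) w = dotv u w + dotv v w.
Proof. by rewrite ![dotv _ w]dotvC dotvDr. Qed.

Lemma dotvZl c u v : dotv (c *: u) v = c * dotv u v.
Proof. by rewrite ![dotv _ v]dotvC dotvZr. Qed.

Lemma dotvBr u v w : dotv u (v - w) = dotv u v - dotv u w.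
Proof. by rewrite -scaleN1r dotvDr dotvZr mulN1r. Qed.

End DotProduct.

Lemma dotv_mulmxl (K : realType) (m n : nat) (M : 'M[K]_(m, n))
  (u : 'cV[K]_n) (v : 'cV[K]_m) : dotv (M *m u) v = dotv u (M^T *m v).
Proof. by rewrite /dotv trmx_mul mulmxA. Qed.

(** The objective is quadratic, so its Taylor expansion stops at order two and is exact. Symmetry of
    [G] merges the two cross terms, which makes [G *m x - a] the gradient at [x]. *)
Lemma quad_obj_line (K : realType) (n : nat) (G : 'M[K]_n)
  (a x z : 'cV[K]_n) (t : K) : G^T = G ->
  quad_obj G a (x + t *: z) - quad_obj G a x
    = t * dotv z (G *m x - a) + t ^+ 2 / 2 * dotv z (G *m z).
Proof.
move=> G_sym; have xGz : dotv x (G *m z) = dotv z (G *m x).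
  by rewrite dotvC dotv_mulmxl G_sym.
rewrite /quad_obj mulmxDr -scalemxAr !(dotvBr, dotvDl, dotvDr, dotvZl, dotvZr).
by rewrite xGz (dotvC z a); field.
Qed.

(** Both identities are read off blockwise: the first from the lower right block of the identity
    matrix, the second from the zero block below [R]. *)
Lemma working_set_factorization_null (K : realType) (n k : nat)
  (G : 'M[K]_n) (A : 'M[K]_(n, k)) (J1 : 'M[K]_(n, k)) (J2 : 'M[K]_(n, n - k))
  (R : 'M[K]_k) :
  working_set_factorization G A (row_mx J1 J2) R ->
  J2^T *m G *m J2 = 1%:M /\ J2^T *m A = 0.
Proof.
case=> _ _; rewrite tr_row_mx !mul_col_mx => JGJ /eq_col_mx[_ J2A].
split=> //; move: JGJ.
by rewrite !mul_mx_row -block_mxEv scalar_mx_block => /eq_block_mx[].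
Qed.

Theorem proposition4p3 (K : realType) (n k : nat)
  (G : 'M[K]_n) (a : 'cV[K]_n)
  (G_sym : G^T = G) (G_pd : posdef G)
  (A : 'M[K]_(n, k)) (A_rank : \rank A = k)
  (bA : 'cV[K]_k) (nstar : 'cV[K]_n)
  (x : 'cV[K]_n) (u : 'cV[K]_k) (ustar : K)
  (x_active : A^T *m x = bA)
  (x_stat : G *m x - a = A *m u + ustar *: nstar)
  (J : 'M[K]_(n, k + (n - k))) (R : 'M[K]_k)
  (JR : working_set_factorization G A J R)
  (J1 : 'M[K]_(n, k)) (J2 : 'M[K]_(n, n - k)) (J_split : J = row_mx J1 J2)
  (d : 'cV[K]_(k + (n - k))) (d_def : d = J^T *m nstar)
  (d1 : 'cV[K]_k) (d2 : 'cV[K]_(n - k)) (d_split : d = col_mx d1 d2)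
  (z : 'cV[K]_n) (z_def : z = J2 *m d2)
  (r : 'cV[K]_k) (r_def : r = invmx R *m d1)
  (t : K) :
  [/\ quad_obj G a (x + t *: z) - quad_obj G a x
        = t * (t / 2 + ustar) * dotv nstar z,
      z != 0 -> t != 0 -> 0 <= t * ustar ->
        0 < quad_obj G a (x + t *: z) - quad_obj G a x
    & z != 0 -> 0 < t -> 0 <= ustar ->
        0 < quad_obj G a (x + t *: z) - quad_obj G a x].
Proof.
rewrite {}J_split in JR d_def.
have [J2GJ2 J2A] := working_set_factorization_null JR.
have d2E : d2 = J2^T *m nstar.
  by move: d_def; rewrite d_split tr_row_mx mul_col_mx => /eq_col_mx[].
(* Moving [J2] across the product creates the factor [J2^T *m A], which vanishes. *)
have zAu : dotv z (A *m u) = 0.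
  by rewrite z_def dotv_mulmxl mulmxA J2A mul0mx /dotv mulmx0 mxE.
(* Both sides reduce to [dotv d2 d2]: the left by [J2^T *m G *m J2 = 1%:M], the right by
   [d2 = J2^T *m nstar]. *)
have zGz : dotv z (G *m z) = dotv nstar z.
  rewrite (dotvC nstar) z_def !dotv_mulmxl -d2E.
  by rewrite !mulmxA J2GJ2 mul1mx.
have incr : quad_obj G a (x + t *: z) - quad_obj G a x
    = t * (t / 2 + ustar) * dotv nstar z.
  rewrite quad_obj_line // x_stat dotvDr dotvZr zAu zGz (dotvC z).
  by field.
have incr_gt0 : z != 0 -> t != 0 -> 0 <= t * ustar ->
    0 < quad_obj G a (x + t *: z) - quad_obj G a x.
  move=> z_neq0 t_neq0 tu_ge0; rewrite incr; apply: mulr_gt0.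
    (* The scalar factor expands to [t * t / 2 + t * ustar], a positive term plus a nonnegative
       one. *)
    have t2_gt0 : 0 < t * t by rewrite -expr2 exprn_even_gt0.
    by rewrite mulrDr mulrA ltr_wpDr // divr_gt0.
  (* Read as [dotv z (G *m z)], the remaining factor is positive by definiteness of [G]. *)
  by rewrite -zGz G_pd.
split=> // z_neq0 t_gt0 u_ge0; apply: incr_gt0 => //.
  by rewrite gt_eqF.
by rewrite mulr_ge0 // ltW.
Qed.
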